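(* Let $\varepsilon > 0$. Then there exists a non-degenerate system of two homogeneous linear equations with integer coefficients in four variables, and an integer $N$, such that for every finite set $S \subseteq \mathbb{Z}$ with $|S| \geq N$, there are no more than $\varepsilon|S|^2$ solutions $(x_1,x_2,x_3,x_4) \in S^4$ to the system.
   Context: A system of two homogeneous linear equations in four variables, $\sum_{j=1}^4 c_{1j}x_j = 0$ and $\sum_{j=1}^4 c_{2j}x_j=0$ with $c_{ij} \in \mathbb{Z}$, is called non-degenerate if every $2\times 2$ minor of its $2 \times 4$ coefficient matrix $(c_{ij})$ is nonzero (so that the values of any two of the variables determine the other two). *)

(* Defs.v *)
From mathcomp Require Import all_boot all_order all_algebra.
From mathcomp Require Import finmap reals.

Set Implicit Arguments.
Unset Strict Implicit.
Unset Printing Implicit Defensive.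

Import GRing.Theory Num.Theory.

Local Open Scope ring_scope.

(* A 2 x 2 minor of C is the determinant of the two columns picked by an
   increasing f; row i of C holds the coefficients of the i-th equation. *)
Definition nondegenerate_system (C : 'M[int]_(2, 4)) : Prop :=
  forall f : 'I_2 -> 'I_4, {homo f : i j / (i < j)%N} ->
    \det (colsub f C) != 0.

(* S : {fset int} coerces to the finType of its elements, so that
   {ffun 'I_4 -> S} is S^4. *)
Definition solutions (C : 'M[int]_(2, 4)) (S : {fset int}) :
    {set {ffun 'I_4 -> S}} :=
  [set x : {ffun 'I_4 -> S} |
    [forall i : 'I_2, \sum_(j < 4) C i j * val (x j) == 0]].

(* Main.v *)
Require Import Defs.
From mathcomp Require Import all_boot all_order all_algebra.
From mathcomp Require Import finmap reals zify ring.

(* The system is a + b = c, a - p b = d for a large prime p.  Many solutions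
   in S give a dense bipartite graph on S (the pairs (a, b) with c and d in S),
   and a Balog-Szemeredi-Gowers argument yields B in S of positive density in
   which any two b, b' are joined by a proportional number of paths
   b - a - b1 - a' - b'.  Since
     b + p b' = (b + a) - (a - p b1) + (a' - p b1) - (a' - p b'),
   every element of B + p B is obtained from many quadruples of S, so
   |B + p B| <= K |B| with K depending only on the density.  This contradicts
   |X + p X| >= (p - 1) |X|, valid for all large finite X.

   The latter bound is reached by repeatedly improving the constant k in
   p |X + p X| >= k |X|.  After dividing by powers of p, X meets at least two
   residue classes mod p.  Writing X_i for these classes, X + p X is the disjoint
   union of the X_i + p X, and each of them contains X_i + p X_i, for which the
   bound k is already known; a single class with a surplus of |X| / p suffices. *)

Set Implicit Arguments.
Unset Strict Implicit.
Unset Printing Implicit Defensive.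

Import GRing.Theory Num.Theory Order.TTheory.

Local Open Scope fset_scope.

(** * Sums [X + p Y] and residue classes mod [p] *)

Definition affine (p : nat) (a : int) (X : {fset int}) : {fset int} :=
  [fset (a + p%:Z * x)%R | x in X].

Definition sum_dilate (p : nat) (X Y : {fset int}) : {fset int} :=
  [fset (x + p%:Z * y)%R | x in X, y in Y].

Definition residue (p : nat) (i : 'I_p) (X : {fset int}) : {fset int} :=
  [fset x in X | (x %% p)%Z == i].

Lemma affineP p a X z :
  reflect (exists2 x, x \in X & z = a + p%:Z * x)%R (z \in affine p a X).
Proof. exact: (imfsetP _ _ _ _). Qed.

Lemma sum_dilateP p X Y z :
  reflect (exists x y, [/\ x \in X, y \in Y & z = x + p%:Z * y]%R)
          (z \in sum_dilate p X Y).
Proof.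
apply: (iffP (imfset2P _ _ _ _ _)) => /=.
  by case=> x xX [y yY ->]; exists x, y.
by case=> x [y [xX yY ->]]; exists x => //; exists y.
Qed.

Lemma mem_residue p (i : 'I_p) X x :
  (x \in residue i X) = (x \in X) && ((x %% p)%Z == i).
Proof. by rewrite !inE. Qed.

Lemma residue_sub p (i : 'I_p) X : residue i X `<=` X.
Proof. by apply/fsubsetP => x; rewrite mem_residue => /andP[]. Qed.

Lemma sum_dilateSr p X Y Y' : Y `<=` Y' -> sum_dilate p X Y `<=` sum_dilate p X Y'.
Proof.
move=> /fsubsetP sY; apply/fsubsetP => z /sum_dilateP[x [y [xX yY ->]]].
by apply/sum_dilateP; exists x, y; split; last by []; last exact: sY.
Qed.

Lemma residue_sum_dilate p (i : 'I_p) X Y :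
  residue i (sum_dilate p X Y) = sum_dilate p (residue i X) Y.
Proof.
apply/fsetP => z; rewrite mem_residue; apply/andP/sum_dilateP.
  case=> /sum_dilateP[x [y [xX yY ->]]] zi; exists x, y; split=> //.
  by rewrite mem_residue xX -(eqP zi) addrC mulrC modzMDl eqxx.
case=> x [y [+ yY ->]]; rewrite mem_residue => /andP[xX xi].
rewrite [X in (X %% p)%Z]addrC mulrC modzMDl xi; split=> //.
by apply/sum_dilateP; exists x, y; rewrite mulrC.
Qed.

Lemma sum_dilate_affine p a b X Y :
  sum_dilate p (affine p a X) (affine p b Y) =
  affine p (a + p%:Z * b)%R (sum_dilate p X Y).
Proof.
apply/fsetP => z; apply/sum_dilateP/affineP.
  case=> x [y [/affineP[x' xX ->] /affineP[y' yY ->] ->]].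
  exists (x' + p%:Z * y')%R; last by nia.
  by apply/sum_dilateP; exists x', y'.
case=> w /sum_dilateP[x [y [xX yY ->]]] ->.
exists (a + p%:Z * x)%R, (b + p%:Z * y)%R; split; last by nia.
- by apply/affineP; exists x.
- by apply/affineP; exists y.
Qed.

Lemma card_affine p a X : (0 < p)%N -> #|` affine p a X| = #|` X|.
Proof. by move=> p_gt0; apply: card_imfset => x y /=; nia. Qed.

Lemma card_residues p X : (0 < p)%N ->
  #|` X| = (\sum_(i < p) #|` residue i X|)%N.
Proof.
move=> p_gt0; pose c x : 'I_p := insubd (Ordinal p_gt0) `|(x %% p)%Z|%N.
have cE x (i : 'I_p) : (c x == i) = ((x %% p)%Z == i).
  rewrite -val_eqE val_insubd; have -> : (`|(x %% p)%Z| < p)%N by lia.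
  by rewrite /=; lia.
rewrite card_fset_sum1 (partition_big c predT) //=; apply: eq_bigr => i _.
by rewrite card_fset_sum1 big_fset /=; apply: eq_bigl => x; rewrite cE.
Qed.

(** * Lower bounds for [X + p Y] *)

Lemma leq_card_sum_dilate p X Y : (0 < p)%N -> X != fset0 ->
  (#|` Y| <= #|` sum_dilate p X Y|)%N.
Proof.
move=> p_gt0 /fset0Pn[x xX]; rewrite -(card_affine x Y p_gt0).
apply/fsubset_leq_card/fsubsetP => z /affineP[y yY ->].
by apply/sum_dilateP; exists x, y.
Qed.

(** Mod [p], [X + p Y] splits into the sets [X_i + p Y], and each contains a translate of [p Y]. *)
Lemma card_sum_dilate_full p X Y : (0 < p)%N ->
    (forall i : 'I_p, residue i X != fset0) ->
  (p * #|` Y| <= #|` sum_dilate p X Y|)%N.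
Proof.
move=> p_gt0 fullX; rewrite (card_residues (sum_dilate p X Y) p_gt0).
have -> : (p * #|` Y| = \sum_(i < p) #|` Y|)%N by rewrite sum_nat_const card_ord.
apply: leq_sum => i _; rewrite residue_sum_dilate.
exact: leq_card_sum_dilate.
Qed.

Lemma residue_affine p (i : 'I_p) X :
  residue i X = affine p i [fset (x %/ p)%Z | x in residue i X].
Proof.
apply/fsetP => z; apply/idP/affineP.
  move=> zi; exists (z %/ p)%Z; first exact: in_imfset.
  by move: zi; rewrite mem_residue => /andP[_ /eqP<-]; lia.
case=> _ /imfsetP[/= x xi ->] ->; move: (xi).
rewrite mem_residue => /andP[_ /eqP<-].
by have -> : ((x %% p)%Z + p%:Z * (x %/ p)%Z = x)%R by lia.
Qed.

(** Since [d] is invertible mod [p], repeated steps by [d] from one element reach every class. *)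
Lemma full_residues p (d : int) (X : {fset int}) : prime p -> ~~ (p %| d)%Z -> X != fset0 ->
    (forall x, x \in X -> exists2 y, y \in X & (p %| (y - (x + d))%R)%Z) ->
  forall i : 'I_p, residue i X != fset0.
Proof.
move=> p_pr pNd /fset0Pn[x0 x0X] Xd i.
have p_gt0 := prime_gt0 p_pr.
have Xkd k : exists2 y, y \in X & (p %| (y - (x0 + k%:Z * d))%R)%Z.
  elim: k => [|k [y yX dy]]; first by exists x0 => //; rewrite mul0r addr0 subrr dvdz0.
  have [z zX dz] := Xd _ yX; exists z => //.
  suff -> : (z - (x0 + k.+1%:Z * d) = (z - (y + d)) + (y - (x0 + k%:Z * d)))%R.
    exact: rpredD.
  by rewrite -addn1 PoszD; lia.
have cop : coprimez p d by rewrite coprimezE absz_nat prime_coprime.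
have [[u v] /= uv1] := coprimezP _ _ cop.
(* As [v] inverts [d] mod [p], [w] steps lead from [x0] to the class of [i]; the remainder of [w]
   makes this a natural number of steps. *)
set w := ((i%:Z - x0) * v)%R; have := divz_eq w p.
have : (0 <= (w %% p)%Z)%R by lia.
case: (w %% p)%Z => [k _ wE|//]; have [y yX dy] := Xkd k.
apply/fset0Pn; exists y; rewrite mem_residue yX /=.
have iE : (i%:Z %% p)%Z = i by rewrite modz_small //= ltz_nat ltn_ord.
rewrite -[X in _ == X]iE eqz_mod_dvd.
have -> : (y - i%:Z = (y - (x0 + k%:Z * d)) -
                      ((i%:Z - x0) * u + (w %/ p)%Z * d) * p%:Z)%R.
  have {1}-> : (i%:Z = x0 + (i%:Z - x0) * (u * p%:Z + v * d))%R by rewrite uv1; ring.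
  have -> : (k%:Z = w - (w %/ p)%Z * p%:Z)%R by rewrite {1}wE; ring.
  by rewrite /w; ring.
by rewrite rpredB // dvdz_mull.
Qed.

(* Let X_i = i + p X'.  Either X' is invariant mod p under translation by j - i,
   hence meets every class, or some x + j with x in X' lies outside X' + i mod p,
   and x + X_j is then disjoint from X' + X_i. *)
Lemma card_sum_dilate_gain p (i j : 'I_p) X : prime p -> i != j ->
    residue i X != fset0 ->
  (p * #|` residue i X| <= #|` sum_dilate p (residue i X) (residue i X)|)%N \/
  (#|` sum_dilate p (residue i X) (residue i X)| + #|` residue j X| <=
     #|` sum_dilate p (residue i X) X|)%N.
Proof.
move=> p_pr ij Xi0; have p_gt0 := prime_gt0 p_pr.
set Xi := residue i X; set Xj := residue j X.
pose X' := [fset (x %/ p)%Z | x in Xi].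
have XiE : Xi = affine p i X' by exact: residue_affine.
have [/allP /= H|] := boolP (all (fun x =>
    has (fun y => (p %| (y - (x + (j%:Z - i%:Z)))%R)%Z) X') X').
  left; rewrite XiE sum_dilate_affine !card_affine //.
  apply: card_sum_dilate_full => //; apply: (@full_residues _ (j%:Z - i%:Z)%R) => //.
  - by rewrite -eqz_mod_dvd !modz_small //= ?ltz_nat ?ltn_ord // eqz_nat val_eqE eq_sym.
  - case/fset0Pn: Xi0 => x xXi; apply/fset0Pn; exists (x %/ p)%Z; exact: in_imfset.
  - by move=> x /H/hasP.
case/allPn=> x xX' /hasPn /= xN; right.
pose Z := affine p (i%:Z + p%:Z * x)%R Xj.
(* A common element gives [u' + v = x + y] with [v] in class [i] and [y] in class [j], so [u'] is
   congruent to [x + (j - i)], against the choice of [x]. *)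
have dis : [disjoint sum_dilate p Xi Xi & Z]%fset.
  apply/fdisjointP => _ /sum_dilateP[u [v [uXi vXi ->]]].
  apply/negP => /affineP[y yXj E].
  move: uXi vXi; rewrite {1}XiE => /affineP[u' u'X' uE].
  rewrite mem_residue => /andP[_ /eqP vi].
  move: yXj; rewrite mem_residue => /andP[_ /eqP yj].
  move: (xN _ u'X'); apply/negP; rewrite negbK.
  apply/dvdzP; exists ((y %/ p)%Z - (v %/ p)%Z)%R.
  rewrite mulrBl; move: (divz_eq y p) (divz_eq v p); rewrite vi yj.
  move: E; rewrite uE; nia.
rewrite -(card_affine (i%:Z + p%:Z * x)%R Xj p_gt0) -/Z.
move: dis; rewrite -(leq_card_fsetU _ _).2 => /eqP <-.
apply/fsubset_leq_card; rewrite fsubUset sum_dilateSr ?residue_sub //=.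
apply/fsubsetP => _ /affineP[y yXj ->]; apply/sum_dilateP.
exists (i%:Z + p%:Z * x)%R, y; split=> //.
- by rewrite XiE; apply/affineP; exists x.
- by apply: (fsubsetP (residue_sub j X)).
Qed.

(** * Improving the growth constant of [X + p X] *)

Lemma card_sum_dilate_affine p a X : (0 < p)%N ->
  #|` sum_dilate p (affine p a X) (affine p a X)| = #|` sum_dilate p X X|.
Proof. by move=> p_gt0; rewrite sum_dilate_affine card_affine. Qed.

(** Induction on the distance of two distinct elements of [X]: if [X] lies in one class, it is an
    affine image of its set of quotients by [p], where this distance is divided by [p]. *)
Lemma residue_ind p (Q : {fset int} -> Prop) : (1 < p)%N ->
    (forall a X, Q X -> Q (affine p a X)) ->
    (forall X (i j : 'I_p), i != j -> residue i X != fset0 ->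
       residue j X != fset0 -> Q X) ->
  forall X : {fset int}, (1 < #|` X|)%N -> Q X.
Proof.
move=> p_gt1 Qaff Qres X X_gt1; have p_gt0 := ltnW p_gt1.
have [x [y [xX yX xy]]] : exists x y, [/\ x \in X, y \in X & x != y].
  have /fset0Pn[x xX] : (X : {fset int}) != fset0 by rewrite -cardfs_gt0 ltnW.
  have : (X : {fset int}) `\ x != fset0 by rewrite -cardfs_gt0; move: X_gt1; rewrite (cardfsD1 x) xX.
  by case/fset0Pn=> y; rewrite !inE => /andP[yx yX]; exists x, y; rewrite eq_sym.
have [D] := ubnP `|(x - y)%R|%N.
elim: D => // D IH in X x y xX yX xy {X_gt1} *; rewrite ltnS => leD.
have resx z : exists i : 'I_p, (z %% p)%Z = i.
  have lt_z : (`|(z %% p)%Z| < p)%N by lia.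
  by exists (Ordinal lt_z) => /=; lia.
have [i xi] := resx x.
have [XiE|XiX] := residue i X =P X; last first.
  have /fset0Pn[z] : X `\` residue i X != fset0.
    by apply/negP; rewrite fsetD_eq0 => XXi; apply: XiX; apply/eqP; rewrite eqEfsubset residue_sub.
  rewrite in_fsetD mem_residue => /andP[+ zX]; rewrite zX /= => zi.
  have [j zj] := resx z; apply: (Qres X i j).
  - by apply: contraNneq zi => ->; rewrite zj.
  - by apply/fset0Pn; exists x; rewrite mem_residue xX xi eqxx.
  - by apply/fset0Pn; exists z; rewrite mem_residue zX zj eqxx.
rewrite -XiE residue_affine; apply: Qaff.
have yi : (y %% p)%Z = i by move: yX; rewrite -XiE mem_residue => /andP[_ /eqP].
apply: (IH _ (x %/ p)%Z (y %/ p)%Z).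
- by apply: in_imfset; rewrite XiE.
- by apply: in_imfset; rewrite XiE.
- apply: contraNneq xy => E; apply/eqP.
  by rewrite (divz_eq x p) (divz_eq y p) E xi yi.
- have : (`|x - y| = `|(x %/ p)%Z - (y %/ p)%Z| * p)%N.
    by rewrite {1}(divz_eq x p) {1}(divz_eq y p) xi yi; nia.
  have : (0 < `|(x - y)%R|)%N by lia.
  nia.
Qed.

Lemma sum_dilate_growth_step p k N : prime p -> (k <= p * p.-1)%N ->
    (forall X : {fset int}, (N <= #|` X|)%N -> (k * #|` X| <= p * #|` sum_dilate p X X|)%N) ->
  exists M, forall X : {fset int}, (M <= #|` X|)%N ->
    (k.+1 * #|` X| <= p * #|` sum_dilate p X X|)%N.
Proof.
move=> p_pr k_le HN; have p_gt1 := prime_gt1 p_pr; have p_gt0 := ltnW p_gt1.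
(* The [2] is for [residue_ind]. With [p * N], a class of more than [|X| / p] elements has at least
   [N], and a nonempty class of fewer than [N] elements satisfies the bound [k] because its sum with
   [p X] has at least [|X|] elements. *)
exists (maxn 2 (p * N)) => X; rewrite geq_max => /andP[]; move: X.
apply: (residue_ind p_gt1) => [a X IH|X i j ij Xi0 Xj0 N_le].
  by rewrite card_affine // card_sum_dilate_affine.
set n := #|` X| in N_le *.
pose c (l : 'I_p) := #|` residue l X|.
pose s (l : 'I_p) := #|` sum_dilate p (residue l X) X|.
have sE : #|` sum_dilate p X X| = (\sum_(l < p) s l)%N.
  by rewrite (card_residues _ p_gt0); apply: eq_bigr => l _; rewrite residue_sum_dilate.
have nE : n = (\sum_(l < p) c l)%N by exact: card_residues.
have s_ge (l : 'I_p) : (0 < c l)%N -> (n <= s l)%N.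
  by move=> cl; apply: leq_card_sum_dilate => //; rewrite -cardfs_gt0.
have ks_ge (l : 'I_p) : (k * c l <= p * s l)%N.
  have [lt_N|ge_N] := ltnP (c l) N.
    case: (posnP (c l)) => [->|/s_ge]; first by rewrite muln0.
    nia.
  apply: leq_trans (HN _ ge_N) _; rewrite leq_mul2l; apply/orP; right.
  by apply: fsubset_leq_card; apply: sum_dilateSr; exact: residue_sub.
suff [l gain] : exists l : 'I_p, (k * c l + n <= p * s l)%N.
  have -> : (k.+1 * n = k * c l + n + \sum_(l' < p | l' != l) k * c l')%N.
    by rewrite mulSn {2}nE big_distrr (bigD1 l) //= addnC addnAC.
  rewrite sE big_distrr [leqRHS](bigD1 l) //=.
  by rewrite leq_add // leq_sum.
have kp m : (k * m <= p * (p.-1 * m))%N by rewrite mulnA leq_mul2r k_le orbT.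
have pE m : (p * m = p.-1 * m + m)%N by rewrite -{1}(prednK p_gt0) mulSn addnC.
(* A very small class X_l is good: X_l + p X has at least |X| elements.
   Otherwise all nonempty classes have more than |X| / p elements. *)
case: (boolP [exists l : 'I_p, (0 < c l) && (p * c l <= n)]%N).
  case/existsP=> l /andP[cl pcl]; exists l; have := s_ge l cl.
  have := kp (c l); have := pE n; have : (p.-1 * (p * c l) <= p.-1 * n)%N by rewrite leq_mul2l pcl orbT.
  rewrite mulnCA => h1 h2 h3 h4.
  have : (p * n <= p * s l)%N by rewrite leq_mul2l h4 orbT.
  lia.
rewrite negb_exists => /forallP cN.
have cl (l : 'I_p) : residue l X != fset0 -> (n < p * c l)%N.
  by rewrite -cardfs_gt0 => cl; have := cN l; rewrite cl /= ltnNge.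
have [ni nj] := (cl i Xi0, cl j Xj0).
(* The surplus is [p * c i] in the first case and [p * c j] in the second; both exceed [n]. *)
exists i; case: (card_sum_dilate_gain p_pr ij Xi0) => H.
- have le_s : (p * c i <= s i)%N.
    by apply: leq_trans H _; apply/fsubset_leq_card/sum_dilateSr/residue_sub.
  have : (p * (p * c i) <= p * s i)%N by rewrite leq_mul2l le_s orbT.
  by have := kp (c i); have := congr1 (muln p) (pE (c i)); rewrite mulnDr; lia.
- have Nc : (N <= #|` residue i X|)%N.
    by rewrite ltnW // -(ltn_pmul2l p_gt0) (leq_ltn_trans N_le).
  have := HN _ Nc.
  have : (p * (#|` sum_dilate p (residue i X) (residue i X)| + c j) <= p * s i)%N.
    by rewrite leq_mul2l H orbT.
  by rewrite mulnDr -/(c i); lia.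
Qed.

(** The constant [k / p] rises in steps of [1 / p] from the trivial [k = 0] up to
    [k = p * (p - 1)]. *)
Lemma sum_dilate_growth p : prime p ->
  exists N, forall X : {fset int}, (N <= #|` X|)%N ->
    (p.-1 * #|` X| <= #|` sum_dilate p X X|)%N.
Proof.
move=> p_pr; have p_gt0 := prime_gt0 p_pr.
have H k : (k <= p * p.-1)%N -> exists N, forall X : {fset int}, (N <= #|` X|)%N ->
    (k * #|` X| <= p * #|` sum_dilate p X X|)%N.
  elim: k => [|k IH] le_k; first by exists 0%N.
  have [N HN] := IH (ltnW le_k).
  exact: sum_dilate_growth_step p_pr (ltnW le_k) HN.
have [N HN] := H _ (leqnn _); exists N => X /HN.
by rewrite -mulnA leq_pmul2l.
Qed.

(** * Paths in dense bipartite graphs *)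

Definition codeg (T : finType) (G : rel T) (b b' : T) : nat :=
  #|[set a | G a b && G a b']|.

(** A triple [(a, c, a')] lists the three inner vertices of the four-edge path
    [b - a - c - a' - b']. *)
Definition path3 (T : finType) (G : rel T) (b b' : T) : {set T * T * T} :=
  [set t | [&& G t.1.1 b, G t.1.1 t.1.2, G t.2 t.1.2 & G t.2 b']].

Lemma codegC (T : finType) (G : rel T) b b' : codeg G b b' = codeg G b' b.
Proof. by congr #|pred_of_set _|; apply/setP => a; rewrite !inE andbC. Qed.

Lemma card_setE (T : finType) (P : pred T) :
  #|[set x | P x]| = (\sum_x P x)%N.
Proof. by rewrite cardsE -sum1_card [LHS]big_mkcond; apply: eq_bigr. Qed.

Lemma sum_nat_constT (T : finType) c : (\sum_(x : T) c = #|T| * c)%N.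
Proof. by rewrite big_const iter_addn_0 mulnC. Qed.

Lemma card_path3 (T : finType) (G : rel T) b b' :
  #|path3 G b b'| = (\sum_c codeg G b c * codeg G c b')%N.
Proof.
transitivity (\sum_c \sum_a \sum_a' (G a b && G a c) * (G a' c && G a' b'))%N.
  rewrite card_setE exchange_big /= pair_big pair_big /=; apply: eq_bigr => t _.
  by rewrite mulnb andbA.
apply: eq_bigr => c _; rewrite /codeg !card_setE big_distrl /=.
by apply: eq_bigr => a _; rewrite big_distrr.
Qed.

(* Averaging over a: the sum counts the pairs of neighbours of a with low
   codegree, and such a pair has few common neighbours a by definition. *)
Lemma exists_rich_neighborhood (T : finType) (G : rel T) m :
    (0 < #|T|)%N -> (#|T| ^ 2 <= m * \sum_a #|[set b | G a b]|)%N ->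
  exists a, (#|T| ^ 2 + 16 * m ^ 2 *
      \sum_(b | G a b) #|[set c | G a c & 16 * m ^ 2 * codeg G b c < #|T|]|
    <= 2 * m ^ 2 * #|[set b | G a b]| ^ 2)%N.
Proof.
set n := #|T| => n_gt0 dense; set M := (16 * m ^ 2)%N.
pose d a := #|[set b | G a b]|.
pose bad a := (\sum_(b | G a b) #|[set c | G a c & M * codeg G b c < n]|)%N.
have bad_le : (M * \sum_a bad a <= n ^ 3)%N.
  have -> : (\sum_a bad a = \sum_b \sum_(c | M * codeg G b c < n) codeg G b c)%N.
    rewrite (eq_bigr (fun a => \sum_b \sum_(c | M * codeg G b c < n) (G a b && G a c)))%N.
      rewrite exchange_big; apply: eq_bigr => b _ /=.
      by rewrite exchange_big; apply: eq_bigr => c _ /=; rewrite /codeg card_setE.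
    move=> a _; rewrite /bad big_mkcond; apply: eq_bigr => b _ /=.
    case: (G a b) => /=; last by rewrite big1.
    rewrite card_setE [RHS]big_mkcond; apply: eq_bigr => c _.
    by case: (G a c); case: ifP.
  have -> : (n ^ 3 = \sum_(b : T) \sum_(c : T) n)%N.
    by rewrite !sum_nat_constT -/n; lia.
  rewrite big_distrr leq_sum // => b _; rewrite big_distrr /= big_mkcond leq_sum //= => c _.
  by case: ifP => // /ltnW.
(* Cauchy-Schwarz, obtained by summing [2 x y <= x ^ 2 + y ^ 2] at [x = m * d a] and [y = n]. *)
have d_ge : (n ^ 3 <= m ^ 2 * \sum_a d a ^ 2)%N.
  have : (\sum_a 2 * ((m * d a) * n) <= \sum_a ((m * d a) ^ 2 + n ^ 2))%N.
    by apply: leq_sum => a _; exact: nat_Cauchy.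
  have -> : (\sum_a 2 * ((m * d a) * n) = 2 * ((m * \sum_a d a) * n))%N.
    by rewrite -big_distrr -big_distrl -big_distrr.
  have -> : (\sum_a ((m * d a) ^ 2 + n ^ 2) = m ^ 2 * \sum_a d a ^ 2 + n * n ^ 2)%N.
    rewrite big_split sum_nat_constT big_distrr /=; congr (_ + _)%N.
    by apply: eq_bigr => a _; rewrite expnMn.
  by have : (n ^ 2 * n <= m * (\sum_a d a) * n)%N := leq_mul dense (leqnn n); lia.
(* If every [a] failed, summing would contradict [bad_le] and [d_ge]; the successors add up to
   [n > 0], which makes the inequality strict. *)
apply/existsP; apply: contraT; rewrite negb_exists => /forallP H.
have : (\sum_a (2 * m ^ 2 * d a ^ 2).+1 <= \sum_a (n ^ 2 + M * bad a))%N.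
  by apply: leq_sum => a _; rewrite ltnNge H.
have -> : (\sum_a (2 * m ^ 2 * d a ^ 2).+1 = 2 * (m ^ 2 * \sum_a d a ^ 2) + n)%N.
  rewrite mulnA big_distrr /= -[X in (_ + X)%N]muln1 -sum_nat_constT -big_split.
  by apply: eq_bigr => a _; exact/esym/addn1.
rewrite big_split sum_nat_constT -big_distrr -/n -expnS /=.
lia.
Qed.

(** In a rich neighbourhood [D], keep as [B] the vertices of low codegree with at most a quarter of
    [D]. For [b] and [b'] in [B], at least half of the [c] in [D] have high codegree with both, and
    each of these gives at least [(n / M) ^ 2] paths. *)
Lemma many_path3 (T : finType) (G : rel T) m :
    (0 < #|T|)%N -> (#|T| ^ 2 <= m * \sum_a #|[set b | G a b]|)%N ->
  exists B : {set T}, (#|T| <= 4 * m * #|B|)%N /\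
    forall b b', b \in B -> b' \in B ->
      (#|T| ^ 3 <= 1024 * m ^ 5 * #|path3 G b b'|)%N.
Proof.
move=> n_gt0 /(exists_rich_neighborhood n_gt0)[a].
set n := #|T| in n_gt0 *; set M := (16 * m ^ 2)%N; set D := [set b | G a b].
pose low b := [set c | G a c & M * codeg G b c < n]%N.
set d := #|D| => richD.
have rich : (n ^ 2 + M * (\sum_(b | G a b) #|low b|) <= 2 * m ^ 2 * d ^ 2)%N := richD.
have m_gt0 : (0 < m)%N by rewrite lt0n; apply: contraTneq rich => ->; lia.
have n_le : (n <= 2 * m * d)%N by rewrite -leq_sqr !expnMn; lia.
have d_gt0 : (0 < d)%N by lia.
have low_le : (8 * \sum_(b in D) #|low b| <= d ^ 2)%N.
  rewrite (eq_bigl (G a)) => [|b]; last by rewrite inE.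
  by rewrite -(leq_pmul2l (_ : 0 < 2 * m ^ 2)%N) ?muln_gt0 ?expn_gt0 ?m_gt0 //; lia.
pose B := [set b in D | 4 * #|low b| <= d]%N.
exists B; split.
  have BD : (#|B| + #|D :\: B| = d)%N.
    rewrite /d -(cardsID B D); congr (#|pred_of_set _| + _)%N.
    by apply/esym/setIidPr/subsetP => b; rewrite inE => /andP[].
  (* Markov: a vertex of [D] outside [B] has [#|low b| > d / 4], so by [low_le] at most [d / 2]
     vertices are lost. *)
  have : (#|D :\: B| * d <= 4 * \sum_(b in D) #|low b|)%N.
    rewrite -sum_nat_const big_distrr /= [leqRHS](big_setID B) /=.
    rewrite setIC (setIidPl _); last by apply/subsetP => b; rewrite inE => /andP[].
    apply: leq_trans (leq_addl _ _); apply: leq_sum => b.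
    by rewrite !inE => /andP[/nandP[/negPf->//|]]; rewrite -ltnNge => /ltnW.
  move=> BDd; have : (2 * #|D :\: B| <= d)%N.
    by rewrite -(leq_pmul2r d_gt0); move: low_le; rewrite -mulnn; lia.
  move=> h; have : (2 * m * d <= 2 * m * (2 * #|B|))%N by rewrite leq_mul2l; apply/orP; right; lia.
  lia.
move=> b b'; rewrite !inE => /andP[Gab lowb] /andP[Gab' lowb'].
pose good := D :\: (low b :|: low b').
have good_ge : (d <= 2 * #|good|)%N.
  have := (leq_card_setU (low b) (low b')).1; have := cardsD D (low b :|: low b').
  have := subset_leq_card (subsetIr D (low b :|: low b')).
  by rewrite -/good -/d; lia.
have : (#|good| * n ^ 2 <= M ^ 2 * #|path3 G b b'|)%N.
  rewrite card_path3 -sum_nat_const big_distrr /= big_mkcond /=.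
  apply: leq_sum => c _; case: ifP => //; rewrite !inE.
  case/andP=> + Gac; rewrite Gac /= => /norP[]; rewrite -!leqNgt => h1 h2.
  by rewrite -!mulnn mulnACA leq_mul // codegC.
rewrite /M => h.
have : (n ^ 3 <= 2 * m * d * n ^ 2)%N by rewrite expnS leq_mul2r n_le orbT.
have : (4 * m * (#|good| * n ^ 2) <= 4 * m * ((16 * m ^ 2) ^ 2 * #|path3 G b b'|))%N.
  by rewrite leq_mul2l h orbT.
have : (m * n ^ 2 * d <= m * n ^ 2 * (2 * #|good|))%N by rewrite leq_mul2l good_ge orbT.
have -> : (1024 * m ^ 5 * #|path3 G b b'| = 4 * m * ((16 * m ^ 2) ^ 2 * #|path3 G b b'|))%N.
  by ring.
lia.
Qed.

(** * From paths to an upper bound for [Y + p Y] *)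

Definition dilate_rel (p : nat) (S : {fset int}) : rel S :=
  fun a b => (val a + val b \in S)%R && (val a - p%:Z * val b \in S)%R.

Lemma sum_card_fibers (T : finType) (f : T -> int) (D : {fset int}) :
  (\sum_(s <- D) #|[set t | f t == s]| <= #|T|)%N.
Proof.
under eq_bigr do rewrite card_setE.
rewrite exchange_big /= -sum1_card; apply: leq_sum => t _.
have -> : (\sum_(s <- D) (f t == s) = count_mem (f t) D)%N.
  by rewrite -sum1_count [RHS]big_mkcond; apply: eq_bigr => s _; rewrite /= eq_sym; case: eqP.
by rewrite count_uniq_mem ?fset_uniq //; case: (_ \in _).
Qed.

(** Each path writes [b + p b'] as an alternating sum of four elements of [S], one per edge. Given
    [b] and [b'], these four determine the path, so each sum has at least [q / K] representations
    among the [|S| ^ 4] quadruples. *)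
Lemma card_sum_dilate_path3 p (S : {fset int}) (B : {set S}) q K : (0 < p)%N ->
    (forall b b', b \in B -> b' \in B ->
       (q <= K * #|path3 (@dilate_rel p S) b b'|)%N) ->
  (#|` sum_dilate p [fset val b | b in B] [fset val b | b in B]| * q <= K * #|` S| ^ 4)%N.
Proof.
move=> p_gt0 HB; set Y := [fset val b | b in B].
pose phi (t : S * S * S * S) : int :=
  (val t.1.1.1 - val t.1.1.2 + val t.1.2 - val t.2)%R.
have -> : (#|` S| ^ 4 = #|{: S * S * S * S}|)%N by rewrite !card_prod -cardfE; lia.
apply: leq_trans (leq_mul (leqnn K) (sum_card_fibers phi (sum_dilate p Y Y))).
rewrite card_fset_sum1 big_distrl big_distrr /= big_seq [leqRHS]big_seq.
apply: leq_sum => s /sum_dilateP[_ [_ [/imfsetP[/= b bB ->] /imfsetP[/= b' b'B ->] sE]]].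
rewrite mul1n; apply: leq_trans (HB _ _ bB b'B) _; rewrite leq_mul2l; apply/orP; right.
(* On paths all four values lie in [S], so the default [b] is never returned. *)
pose f (t : S * S * S) : S * S * S * S :=
  (insubd b (val t.1.1 + val b)%R, insubd b (val t.1.1 - p%:Z * val t.1.2)%R,
   insubd b (val t.2 - p%:Z * val t.1.2)%R, insubd b (val t.2 - p%:Z * val b')%R).
have fE t : t \in path3 (@dilate_rel p S) b b' ->
  [/\ val (f t).1.1.1 = val t.1.1 + val b, val (f t).1.1.2 = val t.1.1 - p%:Z * val t.1.2,
      val (f t).1.2 = val t.2 - p%:Z * val t.1.2 & val (f t).2 = val t.2 - p%:Z * val b']%R.
  rewrite inE => /and4P[/andP[h1 _] /andP[_ h2] /andP[_ h3] /andP[_ h4]].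
  by rewrite /f /= !insubdK.
rewrite -(@card_in_imset _ _ f) => [|t t' /fE[e1 e2 e3 e4] /fE[e1' e2' e3' e4'] E].
  apply/subset_leq_card/subsetP => _ /imsetP[t /fE[e1 e2 e3 e4] ->].
  by rewrite inE sE /phi e1 e2 e3 e4; apply/eqP; ring.
rewrite E in e1 e2 e3 e4; move: e1 e2 e3 e4; rewrite e1' e2' e3' e4'.
case: t t' {E e1' e2' e3' e4'} => [[a c] a'] [[x z] x'] /= h1 h2 h3 h4.
have -> : a = x by apply: val_inj => /=; lia.
have -> : a' = x' by apply: val_inj => /=; lia.
have -> // : c = z by apply: val_inj => /=; nia.
Qed.

(** * The system and its number of solutions *)

Definition dilate_system (p : nat) : 'M[int]_(2, 4) :=
  (\matrix_(i < 2, j < 4)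
     (nth [::] [:: [:: 1; 1; -1; 0]; [:: 1; - p%:Z; 0; -1]] i)`_j)%R.

Lemma dilate_system_nondegenerate p : (0 < p)%N ->
  nondegenerate_system (dilate_system p).
Proof.
move=> p_gt0 f fhomo; have lt_f : (f ord0 < f ord_max)%N by exact: fhomo.
rewrite (expand_det_row _ ord0) !big_ord_recl big_ord0 /cofactor !det_mx11 !mxE /=.
have -> : lift ord0 ord0 = ord_max :> 'I_2 by exact: val_inj.
have -> : lift ord_max 0%R = ord0 :> 'I_2 by exact: val_inj.
rewrite /bump /= addn0 expr0 expr1 mul1r mulN1r addr0.
move: lt_f.
(* In lexicographic order of columns, the minors are [-(p + 1)], [1], [-1], [-p], [-1], [1]. *)
case: (f ord0) => [[|[|[|[|?]]]] ?] //; case: (f ord_max) => [[|[|[|[|?]]]] ?] //= _; lia.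
Qed.

(** The first two coordinates of a solution determine it and form an edge. *)
Lemma card_solutions_le p (S : {fset int}) :
  (#|solutions (dilate_system p) S| <=
     \sum_a #|[set b | @dilate_rel p S a b]|)%N.
Proof.
have -> : (\sum_a #|[set b | @dilate_rel p S a b]| =
          #|[set t : S * S | @dilate_rel p S t.1 t.2]|)%N.
  by rewrite card_setE; under eq_bigr do rewrite card_setE; rewrite pair_big.
pose f (x : {ffun 'I_4 -> S}) := (x (inord 0), x (inord 1)).
have solE x : x \in solutions (dilate_system p) S ->
  (val (x (inord 2)) = val (x (inord 0)) + val (x (inord 1)) /\
   val (x (inord 3)) = val (x (inord 0)) - p%:Z * val (x (inord 1)))%R.
  rewrite inE => /forallP H.
  have sum4 (F : 'I_4 -> int) : (\sum_j F j = F (inord 0) + F (inord 1) + F (inord 2) + F (inord 3))%R.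
    rewrite !big_ord_recr big_ord0 /= add0r.
    by congr (F _ + F _ + F _ + F _)%R; apply: val_inj; rewrite /= inordK.
  move: (H ord0) (H ord_max); rewrite !sum4 !mxE !inordK //= => /eqP h1 /eqP h2.
  by split; lia.
rewrite -(@card_in_imset _ _ f) => [|x y /solE[x2 x3] /solE[y2 y3] [e0 e1]].
  apply/subset_leq_card/subsetP => _ /imsetP[x /solE[x2 x3] ->].
  by rewrite inE /= /dilate_rel -x2 -x3; apply/andP; split; exact: valP.
apply/ffunP => j; have [->|->|->|->] : [\/ j = inord 0, j = inord 1, j = inord 2 | j = inord 3].
- case: j => [[|[|[|[|//]]]] lt_j]; [constructor 1|constructor 2|constructor 3|constructor 4];
    by apply: val_inj; rewrite /= inordK.
- exact: e0.
- exact: e1.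
- by apply: val_inj; rewrite x2 y2 e0 e1.
- by apply: val_inj; rewrite x3 y3 e0 e1.
Qed.

Lemma few_dilate_solutions m : (0 < m)%N ->
  exists p, (0 < p)%N /\ exists N, forall S : {fset int}, (N <= #|` S|)%N ->
    (m * #|solutions (dilate_system p) S| <= #|` S| ^ 2)%N.
Proof.
(* [4096 * m ^ 6] is the factor [1024 * m ^ 5] lost on paths times the factor [4 * m] lost in
   passing from [S] to [B]; [p - 1] must exceed it. *)
move=> m_gt0; have [p p_gt p_pr] := prime_above (4096 * m ^ 6).+1.
have p_gt0 := prime_gt0 p_pr; exists p; split=> //.
have [N HN] := sum_dilate_growth p_pr.
(* As [|S| <= 4 * m * |B|], this forces [|B| >= N]; the successor also makes [S] nonempty. *)
exists (4 * m * N).+1 => S S_ge; rewrite leqNgt; apply/negP => many.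
set n := #|` S| in S_ge many; have nE : n = #|{: S}| by exact: cardfE.
have n_gt0 : (0 < n)%N by exact: leq_trans S_ge.
have [||B [B_ge HB]] := @many_path3 S (@dilate_rel p S) m; rewrite -?nE //.
  by apply: leq_trans (ltnW many) _; rewrite leq_mul2l card_solutions_le orbT.
rewrite -nE in B_ge HB; pose Y := [fset val b | b in B].
have YE : #|` Y| = #|B| by rewrite card_imfset ?cardE //; exact: val_inj.
have B_gt0 : (0 < #|B|)%N by move: B_ge; case: #|B| => //; rewrite muln0; lia.
have NB : (N <= #|B|)%N.
  by rewrite -(leq_pmul2l (_ : 0 < 4 * m)%N) ?muln_gt0 //; lia.
have upper : (#|` sum_dilate p Y Y| <= 1024 * m ^ 5 * n)%N.
  rewrite -(leq_pmul2r (_ : 0 < n ^ 3)%N) ?expn_gt0 ?n_gt0 //.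
  by rewrite -mulnA -expnS; apply: card_sum_dilate_path3.
have := HN Y; rewrite YE => /(_ NB) lower.
have : (1024 * m ^ 5 * n <= 1024 * m ^ 5 * (4 * m * #|B|))%N by rewrite leq_mul2l B_ge orbT.
have : (4096 * m ^ 6 < p.-1)%N by lia.
rewrite -(ltn_pmul2r B_gt0).
have -> : (4096 * m ^ 6 * #|B| = 1024 * m ^ 5 * (4 * m * #|B|))%N by ring.
lia.
Qed.

Local Open Scope ring_scope.

Theorem theorem5p1 (R : realType) (eps : R) (heps : 0 < eps) :
  exists C : 'M[int]_(2, 4), nondegenerate_system C /\
    exists N : int, forall S : {fset int}, N <= #|` S|%:Z ->
      #|solutions C S|%:R <= eps * #|` S|%:R ^+ 2.
Proof.
(* An [m] above [1 / eps] turns the bound [|S| ^ 2 / m] into [eps * |S| ^ 2]. *)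
have bound_gt := archi_boundP (ltW (etrans (invr_gt0 eps) heps)).
set m := Num.bound eps^-1 in bound_gt.
have m_gt0 : (0 < m)%N by rewrite -(ltr0n R) (lt_trans _ bound_gt) // invr_gt0.
have [p [p_gt0 [N HN]]] := few_dilate_solutions m_gt0.
exists (dilate_system p); split; first exact: dilate_system_nondegenerate.
exists N => S; rewrite lez_nat => /HN.
rewrite -(ler_nat R) natrM natrX => le_sq.
rewrite mulrC -ler_pdivrMr // mulrC.
by apply: le_trans le_sq; rewrite ler_wpM2r // ltW.
Qed.
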